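(* Let $\{p_\theta(x):\theta\in\Theta\}$, with $\Theta\subseteq\mathbb{R}$, be a family of probability density functions for a continuous random variable $X$ on a domain $\mathbb{D}\subseteq\mathbb{R}$, where $p_\theta(x)$ has a second-order derivative with respect to $\theta$. Let $\hat\theta=\hat\theta(x)$ be an unbiased estimator of $\theta$, i.e. $\int \hat\theta(x)p_\theta(x)\,dx=\theta$ for every $\theta\in\Theta$. Then $$\Delta\hat\theta^2\;\ge\;\frac{4\,\mathbb{E}_I^2}{I_2},$$ where $$\Delta\hat\theta^2=\int(\hat\theta(x)-\theta)^2p_\theta(x)\,dx,\qquad I_2=4\int\big(\partial_\theta^2\sqrt{p_\theta(x)}\big)^2dx,\qquad \mathbb{E}_I=\int(\hat\theta(x)-\theta)\big(\partial_\theta\sqrt{p_\theta(x)}\big)^2dx.$$ The same bound holds for a differentiable and locally unbiased estimator $\hat\theta$, i.e. one with $\mathbb{E}[\hat\theta]=\int\hat\theta(x)p_\theta(x)\,dx=\theta$ for $\theta\in[\theta_0-\epsilon,\theta_0+\epsilon]$.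
   Context: All integrals are over $\mathbb{D}$. $\partial_\theta$ and $\partial_\theta^2$ denote the first and second derivatives with respect to the parameter $\theta$. $\Delta\hat\theta^2$ is the variance of the estimator $\hat\theta$, and $I_2$ is called the second-order information of the family. In the local case, $\theta_0$ is the parameter value around which local unbiasedness is required and $\epsilon$ is the half-width of the interval.
   Formalization: Adds that the integrals of p_θ and of θ̂p_θ may be differentiated twice in θ under the integral (false otherwise), and that √p_θ(x) is twice differentiable in θ for a.e. x; the bound is stated at interior points of Θ, where the derivatives are defined. *)

(* Defs.v *)
From HB Require Import structures.
From mathcomp Require Import all_boot all_order all_algebra.
From mathcomp Require Import all_classical all_reals all_analysis.

Set Implicit Arguments.
Unset Strict Implicit.
Unset Printing Implicit Defensive.

Import Order.TTheory GRing.Theory Num.Theory.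
Import numFieldNormedType.Exports.

Local Open Scope classical_set_scope.
Local Open Scope ring_scope.

(* A parametric family of functions is [f : R -> R -> R], the parameter theta
   coming first: [f theta x]. *)

(* The derivative with respect to the parameter; [dparam (dparam f)] is the
   second derivative with respect to the parameter. *)
Definition dparam (R : realType) (f : R -> R -> R) : R -> R -> R :=
  fun theta x => derive1 (fun t => f t x) theta.

(* The first derivative has to exist on a neighbourhood of [t] for the second
   derivative at [t] to make sense. *)
Definition twice_derivable (R : realType) (g : R -> R) (t : R) : Prop :=
  (\forall s \near t, derivable g s 1) /\ derivable (derive1 g) t 1.

Definition sqrt_family (R : realType) (p : R -> R -> R) : R -> R -> R :=
  fun theta x => Num.sqrt (p theta x).

Definition pdf_on (R : realType) (D : set R) (q : R -> R) : Prop :=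
  [/\ measurable_fun D q,
      forall x, D x -> 0 <= q x &
      (\int[lebesgue_measure]_(x in D) (q x)%:E = 1)%E].

(* The expectation is extended-real valued, so that the equation also says
   that [that x * p theta x] is integrable over [D]. *)
Definition unbiased_on (R : realType) (D : set R) (p : R -> R -> R)
    (that : R -> R) (S : set R) : Prop :=
  forall theta, S theta ->
    (\int[lebesgue_measure]_(x in D) (that x * p theta x)%:E = theta%:E)%E.

(* d/dt \int_D w(x) f_t(x) dx = \int_D w(x) (d/dt f_t(x)) dx  at t = theta *)
Definition diff_under_integral (R : realType) (D : set R) (w : R -> R)
    (f : R -> R -> R) (theta : R) : Prop :=
  lebesgue_measure.-integrable D (fun x => (w x * dparam f theta x)%:E) /\
  is_derive theta 1
    (fun t => (\int[lebesgue_measure]_(x in D) (w x * f t x))%R)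
    (\int[lebesgue_measure]_(x in D) (w x * dparam f theta x))%R.

(* The normalisation \int_D p_t(x) dx and the expectation
   \int_D that(x) p_t(x) dx may be differentiated twice under the integral. *)
Definition regular_at (R : realType) (D : set R) (p : R -> R -> R)
    (that : R -> R) (theta : R) : Prop :=
  [/\ diff_under_integral D (fun=> 1) p theta,
      diff_under_integral D (fun=> 1) (dparam p) theta,
      diff_under_integral D that p theta &
      diff_under_integral D that (dparam p) theta].

Section quantities.
Local Open Scope ereal_scope.

Definition estimator_variance (R : realType) (D : set R) (p : R -> R -> R)
    (that : R -> R) (theta : R) : \bar R :=
  \int[lebesgue_measure]_(x in D) ((that x - theta) ^+ 2 * p theta x)%:E.

Definition info2 (R : realType) (D : set R) (p : R -> R -> R) (theta : R) :
    \bar R :=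
  4%:E * \int[lebesgue_measure]_(x in D)
           ((dparam (dparam (sqrt_family p)) theta x) ^+ 2)%:E.

Definition EI (R : realType) (D : set R) (p : R -> R -> R)
    (that : R -> R) (theta : R) : \bar R :=
  \int[lebesgue_measure]_(x in D)
    ((that x - theta) * (dparam (sqrt_family p) theta x) ^+ 2)%:E.

(* Extended-real division: the right-hand side is 0 when [info2] is +oo, and
   also (as 0 * +oo = 0) when both [EI] and [info2] are 0, whereas it is +oo
   when [info2] is 0 and [EI] is not. *)
Definition second_order_bound (R : realType) (D : set R) (p : R -> R -> R)
    (that : R -> R) (theta : R) : Prop :=
  4%:E * EI D p that theta ^+ 2 / info2 D p theta
    <= estimator_variance D p that theta.

End quantities.

(* Main.v *)
Require Import Defs.
From HB Require Import structures.
From mathcomp Require Import all_boot all_order all_algebra.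
From mathcomp Require Import all_classical all_reals all_analysis.
From mathcomp Require Import measurable_realfun ring lra.

(** Write s for the square root of p_theta, so that p'' = 2 s'^2 + 2 s s''.
    Differentiating the normalisation and the unbiasedness condition twice
    gives \int (that - theta) p'' = 0, that is
    \int (that - theta) s'^2 = - \int (that - theta) s s'', and the bound is
    the Cauchy-Schwarz inequality for (that - theta) s and s''.  Neither s' nor
    s'' is known to be measurable, so s'' is replaced by a measurable function
    of p, p', p'' which agrees with it almost everywhere on the set where p > 0
    and vanishes where p does. *)

Import Order.TTheory GRing.Theory Num.Theory.
Import numFieldNormedType.Exports.

Local Open Scope classical_set_scope.
Local Open Scope ring_scope.

Import HBNNSimple.

(** * Integral comparison up to null sets, and Cauchy-Schwarz *)

(* [f] and [g] need not be measurable: the integral of a nonnegative function is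
   a supremum over the simple functions below it. *)
Lemma ge0_le_integral_null {d} {T : measurableType d} {R : realType}
    {mu : {measure set T -> \bar R}} {D N : set T} (mN : measurable N)
    (muN0 : mu N = 0%E) (f g : T -> \bar R) :
  (forall x, D x -> 0 <= f x)%E -> (forall x, D x -> 0 <= g x)%E ->
  (forall x, D x -> ~ N x -> f x <= g x)%E ->
  (\int[mu]_(x in D) f x <= \int[mu]_(x in D) g x)%E.
Proof.
move=> f0 g0 fg; rewrite !ge0_integralE//.
apply/ge_ereal_sup => _ [h /= hf <-].
apply: le_ereal_sup_tmp.
(* Cutting [h] off to 0 on [N] puts it below [g] everywhere and, [N] being null, leaves its integral
   unchanged. *)
pose h' := proj_nnsfun h (measurableC mN).
exists (sintegral mu h').
  exists h' => //= x; rewrite /h' /= mindicE.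
  have [xN|xN] := boolP (x \in ~` N); last first.
    by rewrite mulr0; apply: erestrict_ge0.
  rewrite mulr1 (le_trans (hf x))// /patch; case: ifPn => // /set_mem Dx.
  by apply: fg => //; exact/set_mem.
rewrite -!integralT_nnsfun.
have mE (k : {nnsfun T >-> R}) : measurable_fun setT (EFin \o k).
  exact/measurable_EFinP.
have E0 (k : {nnsfun T >-> R}) x : setT x -> (0 <= (EFin \o k) x)%E.
  by rewrite lee_fin.
rewrite (ge0_negligible_integral mN measurableT (mE h) (E0 h))//.
rewrite [leRHS](ge0_negligible_integral mN measurableT (mE h') (E0 h'))//.
rewrite le_eqVlt; apply/orP; left; apply/eqP; apply: eq_integral => x.
rewrite inE => -[_ Nx]; rewrite /h' /= mindicE.
by rewrite mem_set// mulr1.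
Qed.

Lemma eq_integral_null {d} {T : measurableType d} {R : realType}
    {mu : {measure set T -> \bar R}} {D N : set T} (mN : measurable N)
    (muN0 : mu N = 0%E) (f g : T -> \bar R) :
  (forall x, D x -> ~ N x -> f x = g x) ->
  (\int[mu]_(x in D) f x = \int[mu]_(x in D) g x)%E.
Proof.
move=> fg; rewrite integralE [RHS]integralE.
by congr (_ - _)%E; apply/eqP; rewrite eq_le;
  apply/andP; split; apply: (ge0_le_integral_null mN muN0) => //= x Dx Nx;
  rewrite ?(funepos_ge0, funeneg_ge0) ?funeposE ?funenegE ?fg.
Qed.

(** The quadratic [r |-> \int (r * u + v)^2] is nonnegative, so its discriminant is at most 0.
    Integrability of [u * v] comes from [|u v| <= u^2 + v^2]. *)
Lemma Rintegral_cauchy_schwarz {d} {T : measurableType d} {R : realType}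
    {mu : {measure set T -> \bar R}} {D : set T} {u v : T -> R} :
  measurable D -> measurable_fun D u -> measurable_fun D v ->
  mu.-integrable D (fun x => (u x ^+ 2)%:E) ->
  mu.-integrable D (fun x => (v x ^+ 2)%:E) ->
  mu.-integrable D (fun x => (u x * v x)%:E) /\
  (\int[mu]_(x in D) (u x * v x)) ^+ 2 <=
    (\int[mu]_(x in D) (u x ^+ 2)) * (\int[mu]_(x in D) (v x ^+ 2)).
Proof.
move=> mD mu_ mv iu iv.
have iuv : mu.-integrable D (fun x => (u x * v x)%:E).
  apply: (le_integrable mD _ _ (integrableD mD iu iv)).
    by apply/measurable_EFinP; exact: measurable_funM.
  move=> x _ /=; rewrite lee_fin [leRHS]ger0_norm ?addr_ge0 ?sqr_ge0//.
  rewrite normrM -(real_normK (num_real (u x))) -(real_normK (num_real (v x))).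
  have := normr_ge0 (u x); have := normr_ge0 (v x).
  move: `|u x| `|v x| => a b; nra.
split=> //.
set C := Rintegral _ _ (fun x => u x * v x).
set U := Rintegral _ _ (fun x => u x ^+ 2).
set V := Rintegral _ _ (fun x => v x ^+ 2).
pose p := Poly [:: V; 2 * C; U].
have : p`_1 ^+ 2 - 4 * p`_2 * p`_0 <= 0.
  rewrite deg_le2_poly_ge0 ?size_Poly// => r.
  rewrite horner_Poly/= mul0r add0r.
  have -> : (U * r + 2 * C) * r + V =
     \int[mu]_(x in D) (r * u x + v x) ^+ 2.
    under eq_Rintegral.
      move=> x _.
      rewrite (_ : _ ^+ 2 = r ^+ 2 * u x ^+ 2 + 2 * r * (u x * v x) + v x ^+ 2); last by ring.
      over.
    have i1 := integrableZl mD (r ^+ 2) iu.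
    have i2 := integrableZl mD (2 * r) iuv.
    rewrite RintegralD//; last exact: (integrableD mD i1 i2).
    rewrite RintegralD//.
    rewrite !RintegralZl// -/U -/C -/V; ring.
  by apply: Rintegral_ge0 => x _; exact: sqr_ge0.
by rewrite !coefE/=; nra.
Qed.

(** * Derivatives in the parameter *)

(** The difference quotient equals [a] for every nonzero increment that stays in the segment. Since
    [t] may be an endpoint, beyond which [f] is unknown, the limit is read off from one side
    only. *)
Lemma is_derive_affine_segment {R : realType} (f : R -> R) (a b : R)
    {c d t l : R} :
  c < d -> t \in `[c, d] -> (forall s, s \in `[c, d] -> f s = a * s + b) ->
  is_derive t 1 f l -> l = a.
Proof.
move=> cd tcd fab df.
pose q h := h^-1 *: (f (h *: (1 : R) + t) - f t).
have qcvg : q h @[h --> 0^'] --> l.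
  rewrite -(derive_val (is_derive := df)).
  exact: (ex_derive (is_derive := df)).
have qa h : h != 0 -> t + h \in `[c, d] -> q h = a.
  move=> h0 thcd; rewrite /q !fab//; last by rewrite [_ *: _]mulr1 addrC.
  by rewrite /GRing.scale/=; field.
move: (tcd); rewrite in_itv/= => /andP[ct td].
have [tltd|dlet] := ltP t d.
  have H : q h @[h --> 0^'+] --> l by exact: cvg_dnbhs_at_right.
  rewrite -(cvg_lim _ H)//; apply: cvg_lim => //.
  apply: cvg_near_cst.
  near=> h; apply: qa; first by rewrite gt_eqF.
  rewrite in_itv/=; apply/andP; split.
    by rewrite (le_trans ct)// lerDl.
  rewrite addrC -lerBrDr; near: h; apply: nbhs_right_le; rewrite subr_gt0//.
have H : q h @[h --> 0^'-] --> l by exact: cvg_dnbhs_at_left.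
rewrite -(cvg_lim _ H)//; apply: cvg_lim => //.
apply: cvg_near_cst.
near=> h; apply: qa; first by rewrite lt_eqF.
rewrite in_itv/=; apply/andP; split.
  rewrite addrC -lerBlDr; near: h; apply: nbhs_left_ge; lra.
by rewrite (le_trans _ td)// gerDl.
Unshelve. all: by end_near. Qed.

(** Near [t] one has [P = S^2], so the product rule, used twice, gives both formulas. A zero of [P]
    is a minimum of [S], whose derivative vanishes there. *)
Lemma sqrt_derivatives {R : realType} {P : R -> R} {t : R} :
  (\forall s \near t, 0 <= P s) ->
  twice_derivable (fun s => Num.sqrt (P s)) t ->
  let S := fun s => Num.sqrt (P s) in
  [/\ derive1 P t = 2 * S t * derive1 S t,
      derive1 (derive1 P) t =
        2 * derive1 S t ^+ 2 + 2 * S t * derive1 (derive1 S) t &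
      P t = 0 -> derive1 S t = 0].
Proof.
move=> P0 [dS ddS] S.
(* The first formula is proved on a neighbourhood, so that it can be differentiated again. *)
have dP : \forall s \near t, derive1 P s = 2 * S s * derive1 S s.
  have := near_join P0; have := dS; apply: filterS2 => s dSs Ps.
  rewrite derive1E -(near_eq_derive (f := S * S)); last first.
    by apply: filterS Ps => r Pr; rewrite /= /S/= -[RHS]sqr_sqrtr.
  rewrite (deriveM (f := S) (g := S))// derive1E /GRing.scale/=.
  rewrite -/S; ring.
split; first exact: nbhs_singleton dP.
  rewrite derive1E (near_eq_derive (g := (2 \*: S) * derive1 S)); last first.
    by apply: filterS dP => s ->.
  have dSt : derivable S t 1 := nbhs_singleton dS.
  rewrite deriveM//; last exact: derivableZ.
  rewrite deriveZ// -!derive1E.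
  rewrite -[(2 \*: S) t]/(2 * S t) /GRing.scale/=; ring.
move=> Pt0.
have [e /= e0 He] : nbhs_ball t [set s | derivable S s 1] by apply/nbhs_ballP.
have Itv s : s \in `](t - e), (t + e)[ -> ball t e s.
  by rewrite in_itv/= /ball/= => /andP[? ?]; rewrite ltr_norml; apply/andP; split; lra.
have : is_derive t 1 S 0.
  apply: (@derive1_at_min _ _ (t - e) (t + e)).
  - lra.
  - by move=> s /Itv /He.
  - by rewrite in_itv/=; apply/andP; split; lra.
  - by move=> s _; rewrite /S Pt0 sqrtr0 sqrtr_ge0.
by move=> dS0; rewrite derive1E derive_val.
Qed.

(** * The inequality at a fixed parameter *)

Lemma measurable_invr (R : realType) :
  measurable_fun setT (@GRing.inv R).
Proof.
rewrite -(setvU [set 0 : R]); apply/measurable_funU => //.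
  exact: measurableC.
split; last exact: measurable_fun_set1.
apply: open_continuous_measurable_fun => [|x].
  exact/closed_openC/closed_eq.
by rewrite inE => /= /eqP; exact: inv_continuous.
Qed.

(** Here [w] stands for [that - theta], [p0], [p1], [p2] for the density and its derivatives, [s1],
    [s2] for those of its square root. Only the former are measurable; the latter enter through
    pointwise identities off a null set. *)
Lemma second_order_information_inequality {d} {T : measurableType d}
    {R : realType} {mu : {measure set T -> \bar R}} {D N : set T}
    {w p0 : T -> R} (p1 p2 : T -> R) {s1 s2 : T -> R} :
  measurable D -> measurable N -> mu N = 0%E ->
  measurable_fun D w -> measurable_fun D p0 -> measurable_fun D p1 ->
  measurable_fun D p2 ->
  (forall x, D x -> 0 <= p0 x) ->
  mu.-integrable D (fun x => (w x * p2 x)%:E) ->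
  \int[mu]_(x in D) (w x * p2 x) = 0 ->
  (forall x, D x -> ~ N x ->
     [/\ p1 x = 2 * Num.sqrt (p0 x) * s1 x,
         p2 x = 2 * s1 x ^+ 2 + 2 * Num.sqrt (p0 x) * s2 x &
         p0 x = 0 -> s1 x = 0]) ->
  (4%:E * (\int[mu]_(x in D) (w x * s1 x ^+ 2)%:E) ^+ 2
     / (4%:E * \int[mu]_(x in D) (s2 x ^+ 2)%:E)
   <= \int[mu]_(x in D) (w x ^+ 2 * p0 x)%:E)%E.
Proof.
move=> mD mN muN0 mw mp0 mp1 mp2 p0_ge0 iwp2 wp2_0 sqrtP.
set V := (X in (_ <= X)%E); set E := (X in (X ^+ 2)%E).
set I := (X in (_ / (_ * X))%E).
have V0 : (0 <= V)%E.
  by apply: integral_ge0 => x Dx; rewrite lee_fin mulr_ge0 ?sqr_ge0// p0_ge0.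
have I0 : (0 <= I)%E.
  by apply: integral_ge0 => x Dx; rewrite lee_fin sqr_ge0.
have [->|Vy] := eqVneq V +oo%E; first by rewrite leey.
have [Iy|Iy] := eqVneq I +oo%E.
  by rewrite Iy gt0_muley ?lte_fin// invey mule0.
have Vfin : V \is a fin_num by rewrite ge0_fin_numE// ltey.
have Ifin : I \is a fin_num by rewrite ge0_fin_numE// ltey.
pose s x := Num.sqrt (p0 x).
(* A measurable substitute for s2, which vanishes where p0 does since 0^-1 = 0. *)
pose g x := (p2 x / 2 - p1 x ^+ 2 / (4 * p0 x)) / s x.
have ms : measurable_fun D s.
  apply: measurableT_comp mp0; apply: continuous_measurable_fun.
  exact: sqrt_continuous.
have mg : measurable_fun D g.
  rewrite /g; apply: measurable_funM; last exact: (measurableT_comp (measurable_invr R)).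
  apply: measurable_funB; first exact: measurable_funM.
  apply: measurable_funM; first exact: measurable_funX.
  apply: (measurableT_comp (measurable_invr R)) => //.
  exact: measurable_funM.
(* Where [p0 > 0], [g] equals [s2]. Where [p0 = 0], [g] is 0, which may differ from [s2]: hence only
   an inequality between the squares. *)
have gP x : D x -> ~ N x ->
    g x ^+ 2 <= s2 x ^+ 2 /\ s1 x ^+ 2 = p2 x / 2 - s x * g x.
  move=> Dx Nx; have [e1 e2 e0] := sqrtP x Dx Nx.
  have ss : s x ^+ 2 = p0 x by rewrite sqr_sqrtr// p0_ge0.
  have [p00|p00] := eqVneq (p0 x) 0.
    have sx0 : s x = 0 by rewrite /s p00 sqrtr0.
    rewrite /g sx0 invr0 mulr0 expr0n/= sqr_ge0; split => //.
    by rewrite e2 (e0 p00) p00 sqrtr0; field.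
  have sx0 : s x != 0 by rewrite -(sqrf_eq0 (s x)) ss.
  have -> : g x = s2 x.
    by rewrite /g e1 e2 -/(s x) -ss; field.
  by split => //; rewrite e2 -/(s x); field.
have iV : mu.-integrable D (fun x => ((w x * s x) ^+ 2)%:E).
  apply/integrableP; split.
    by apply/measurable_EFinP; apply: measurable_funX; exact: measurable_funM.
  rewrite (_ : integral _ _ _ = V) ?ltey//; apply: eq_integral => x.
  rewrite inE => Dx; rewrite /= ger0_norm ?sqr_ge0// exprMn sqr_sqrtr//.
  exact: p0_ge0.
have leG : (\int[mu]_(x in D) (g x ^+ 2)%:E <= I)%E.
  apply: (ge0_le_integral_null mN muN0) => x Dx; rewrite ?lee_fin ?sqr_ge0//.
  by move=> Nx; have [] := gP x Dx Nx.
have iG : mu.-integrable D (fun x => (g x ^+ 2)%:E).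
  apply/integrableP; split; first exact/measurable_EFinP/measurable_funX.
  apply: le_lt_trans (_ : I < +oo)%E; last by rewrite ltey.
  apply: le_trans leG; rewrite le_eqVlt; apply/orP; left; apply/eqP.
  by apply: eq_integral => x _; rewrite /= ger0_norm ?sqr_ge0.
have mws : measurable_fun D (fun x => w x * s x) by exact: measurable_funM.
have [iwsg CS] := Rintegral_cauchy_schwarz mD mws mg iV iG.
set C := Rintegral _ _ _ in CS.
(* Off [N], [w s1^2 = w p2 / 2 - w s g], and the first term integrates to 0. *)
have EC : E = (- C)%:E.
  have -> : E = (\int[mu]_(x in D)
      (2^-1 * (w x * p2 x) - w x * s x * g x)%:E)%E.
    apply: (eq_integral_null mN muN0) => x Dx Nx; congr EFin.
    by have [_ ->] := gP x Dx Nx; ring.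
  have i1 := integrableZl mD 2^-1 iwp2.
  have i2 := integrableB mD i1 iwsg.
  rewrite -[LHS]fineK; last exact: (integrable_fin_num mD i2).
  congr EFin; rewrite -[LHS]/(Rintegral _ _ _) RintegralB//.
  by rewrite RintegralZl// wp2_0 mulr0 sub0r.
have {}CS : C ^+ 2 <= fine V * fine I.
  apply: (le_trans CS); rewrite (_ : Rintegral _ _ _ = fine V); last first.
    congr fine; apply: eq_integral => x; rewrite inE => Dx.
    by rewrite exprMn sqr_sqrtr// p0_ge0.
  rewrite ler_wpM2l ?fine_ge0//; apply: fine_le => //.
  exact: integrable_fin_num.
rewrite EC -(fineK Vfin) -(fineK Ifin) -!EFinM -expr2.
have If0 : 0 <= fine I by exact: fine_ge0.
(* If [I = 0], Cauchy-Schwarz forces [C = 0], and the quotient is 0 by convention. *)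
have [If|If] := eqVneq (fine I) 0.
  move: CS; rewrite If mulr0 => C0.
  have -> : (- C) ^+ 2 = 0.
    by apply/eqP; rewrite sqrrN eq_le C0 sqr_ge0.
  by rewrite mulr0 mul0e lee_fin fine_ge0.
have Ip : 0 < fine I by rewrite lt_def If.
rewrite inver mulf_eq0 (negbTE If) orbF pnatr_eq0/= -EFinM lee_fin sqrrN.
by rewrite -mulf_div divff ?pnatr_eq0// mul1r ler_pdivrMr.
Qed.

(** * From the parametric family to the bound *)

(** On the segment the normalisation is constantly 1 and the mean is [t]: both are affine, so their
    first derivatives are the constants 0 and 1, and their second derivatives vanish. *)
Lemma second_order_bound_segment {R : realType} {Theta D : set R}
    {p : R -> R -> R} {that : R -> R} {c d theta : R} :
  measurable D ->
  (forall t, Theta t -> pdf_on D (p t)) ->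
  {ae lebesgue_measure, forall x : R, D x ->
     twice_derivable (fun t => sqrt_family p t x) theta} ->
  measurable_fun D that ->
  c < d -> `[c, d] `<=` Theta° -> theta \in `[c, d] ->
  unbiased_on D p that `[c, d] ->
  (forall t, t \in `[c, d] -> regular_at D p that t) ->
  second_order_bound D p that theta.
Proof.
move=> mD p_pdf [N [mN muN0 subN]] mthat cd cdT thetacd unb reg.
have cdT' t : t \in `[c, d] -> Theta t.
  by move=> tcd; apply: (@interior_subset _ Theta); exact: cdT.
have int1 t : t \in `[c, d] ->
    \int[lebesgue_measure]_(x in D) (1 * dparam p t x) = 0 /\
    \int[lebesgue_measure]_(x in D) (that x * dparam p t x) = 1.
  move=> tcd; have [[_ d1] _ [_ d2] _] := reg t tcd.
  split.
    apply: (is_derive_affine_segment _ _ 1 cd tcd _ d1) => s scd.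
    rewrite mul0r add0r /Rintegral.
    under eq_integral do rewrite mul1r.
    by have [_ _ ->] := p_pdf s (cdT' _ scd).
  apply: (is_derive_affine_segment _ _ 0 cd tcd _ d2) => s scd.
  by rewrite addr0 mul1r /Rintegral unb.
have int2 : \int[lebesgue_measure]_(x in D) (1 * dparam (dparam p) theta x) = 0 /\
    \int[lebesgue_measure]_(x in D) (that x * dparam (dparam p) theta x) = 0.
  have [_ [_ d1] _ [_ d2]] := reg theta thetacd.
  split.
    apply: (is_derive_affine_segment _ _ 0 cd thetacd _ d1) => s scd.
    by rewrite addr0 mul0r (int1 s scd).1.
  apply: (is_derive_affine_segment _ _ 1 cd thetacd _ d2) => s scd.
  by rewrite mul0r add0r (int1 s scd).2.
have [[i11 _] [i12 _] [i21 _] [i22 _]] := reg theta thetacd.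
have [mp p_ge0 _] := p_pdf theta (cdT' _ thetacd).
(* Measurability of the parameter derivatives is extracted from the integrability with weight 1 in
   [regular_at]. *)
have mdparam q : lebesgue_measure.-integrable D (fun x => (1 * q x)%:E) ->
    measurable_fun D q.
  move=> /(measurable_int _) /measurable_EFinP.
  by apply: eq_measurable_fun => x _; rewrite mul1r.
have mD' : measurable (D : set (measurableTypeR R)) := mD.
have icst : lebesgue_measure.-integrable D
    (fun x => (theta * (1 * dparam (dparam p) theta x))%:E).
  exact: (integrableZl mD' theta i12).
have iw : lebesgue_measure.-integrable D
    (fun x => ((that x - theta) * dparam (dparam p) theta x)%:E).
  apply: eq_integrable mD' _ _ _ (integrableB mD' i22 icst) => // x _ /=.
  by rewrite -EFinB mulrBl mul1r.
pose s := sqrt_family p.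
rewrite /second_order_bound /EI /info2 /estimator_variance.
apply: (@second_order_information_inequality _ (measurableTypeR R) R
   (@lebesgue_measure R) D N
   (fun x => that x - theta) (p theta) (dparam p theta) (dparam (dparam p) theta)
   (dparam s theta) (dparam (dparam s) theta) mD' mN muN0) => //.
- exact: measurable_funB.
- exact: mdparam.
- exact: mdparam.
- under eq_Rintegral do rewrite mulrBl -[X in theta * X]mul1r.
  by rewrite RintegralB// RintegralZl// int2.1 int2.2 mulr0 subr0.
- move=> x Dx Nx; apply: sqrt_derivatives.
    (* [theta] is interior to [Theta], so the densities are nonnegative for all parameters near
       it. *)
    have /cdT : theta \in `[c, d] := thetacd.
    by apply: filterS => t /p_pdf[_ + _]; exact.
  by apply: contrapT => H; apply: Nx; apply: subN => /= /(_ Dx).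
Qed.

Theorem mainTheorem2 (R : realType) (Theta D : set R) (p : R -> R -> R)
    (mD : measurable D)
    (p_pdf : forall theta : R, Theta theta -> pdf_on D (p theta))
    (p_deriv2 : forall theta x : R, Theta° theta -> D x ->
       twice_derivable (fun t => p t x) theta)
    (sqrtp_deriv2 : forall theta : R, Theta° theta ->
       {ae lebesgue_measure, forall x : R, D x ->
          twice_derivable (fun t => sqrt_family p t x) theta}) :
  (forall that : R -> R,
     measurable_fun D that ->
     unbiased_on D p that Theta ->
     (forall theta : R, Theta° theta -> regular_at D p that theta) ->
     forall theta : R, Theta° theta -> second_order_bound D p that theta)
  /\
  (forall (that : R -> R) (theta0 eps : R),
     0 < eps ->
     `[theta0 - eps, theta0 + eps] `<=` Theta ->
     measurable_fun D that ->
     (forall x : R, D° x -> derivable that x 1) ->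
     unbiased_on D p that `[theta0 - eps, theta0 + eps] ->
     (forall theta : R, theta \in `[theta0 - eps, theta0 + eps] ->
        Theta° theta -> regular_at D p that theta) ->
     forall theta : R, theta \in `[theta0 - eps, theta0 + eps] ->
       Theta° theta -> second_order_bound D p that theta).
Proof.
have subsegment (theta a b : R) : a < b -> theta \in `[a, b] -> Theta° theta ->
    exists c d, [/\ c < d, theta \in `[c, d], `[c, d] `<=` Theta° &
                    `[c, d] `<=` `[a, b]].
  move=> ab; rewrite in_itv/= => /andP[at_ tb].
  move=> /(open_interior Theta) [e /= e0 He].
  (* The radius is halved to fit a closed segment into the open ball. If [theta] is an endpoint of
     [[a, b]], the segment extends to one side of it but keeps positive length. *)
  exists (Num.max a (theta - e / 2)), (Num.min b (theta + e / 2)); split.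
  - by rewrite lt_min !gt_max; apply/andP; split; apply/andP; split; lra.
  - by rewrite in_itv/= le_min ge_max; apply/andP; split; apply/andP; split; lra.
  - move=> x; rewrite /= in_itv/= le_min ge_max => /andP[/andP[_ ?] /andP[_ ?]].
    by apply: He; rewrite /ball/= ltr_norml; apply/andP; split; lra.
  - by move=> x; rewrite /= !in_itv/= le_min ge_max => /andP[/andP[-> _] /andP[-> _]].
(* Common form of both claims. Unbiasedness is asked on [Theta] intersected with [[a, b]], because
   in the global case [[a, b]] is an arbitrary segment around [theta] and may leave [Theta]. *)
have local_bound (that : R -> R) a b theta : measurable_fun D that ->
    a < b -> unbiased_on D p that (Theta `&` `[a, b]) ->
    (forall t, t \in `[a, b] -> Theta° t -> regular_at D p that t) ->
    theta \in `[a, b] -> Theta° theta -> second_order_bound D p that theta.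
  move=> mthat ab unb reg tab Tt.
  have [c [d [cd tcd cdT cdab]]] := subsegment theta a b ab tab Tt.
  apply: (second_order_bound_segment mD p_pdf (sqrtp_deriv2 _ Tt) mthat cd cdT tcd).
    move=> t tcd'; apply: unb; split; last exact: cdab.
    by apply: (@interior_subset _ Theta); exact: cdT.
  by move=> t tcd'; apply: reg; [exact: cdab|exact: cdT].
split=> [that mthat unb reg theta Tt|that theta0 eps eps0 _ mthat _ unb reg].
  apply: (local_bound that (theta - 1) (theta + 1)) => //.
  - lra.
  - by move=> t [? _]; exact: unb.
  - by move=> t _; exact: reg.
  - by rewrite in_itv/=; apply/andP; split; lra.
move=> theta tab Tt; apply: (local_bound that (theta0 - eps) (theta0 + eps)) => //.
- lra.
- by move=> t [_ ?]; exact: unb.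
Qed.
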